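(* Let $B$ be a positive integer (the bin capacity) and let $L=(a_1,\ldots,a_n)$ be any list of items with integer sizes $s(a_i)$, $1\le s(a_i)\le B$. Let $s(L)=\sum_{i=1}^n s(a_i)$, let $OPT(L)$ be the minimum number of bins of capacity $B$ into which the items of $L$ can be packed, and let $SS(L)$ be the number of bins used by the Sum of Squares algorithm on $L$. Then $$SS(L) ~<~ \frac{25}{9}\cdot\frac{s(L)}{B}+2 ~\le~ \frac{25}{9}\,OPT(L)+2.$$
   Context: Bin packing: a packing partitions the items into bins so that the total size of the items in each bin (the bin's level) is at most $B$. The Sum of Squares algorithm (SS) is an on-line algorithm that processes the items $a_1,\ldots,a_n$ in order, assigning each to a bin without knowledge of future items. For a current packing $P$ and $1\le h\le B-1$, let $n_h(P)$ be the number of bins of $P$ whose level equals $h$, and let $ss(P)=\sum_{h=1}^{B-1} n_h(P)^2$. When an item of size $s$ arrives, SS places it either into a new (empty) bin or into a partially filled bin of level at most $B-s$, choosing among these options one that minimizes $ss(P')$ for the resulting packing $P'$ (if several options attain the minimum, any of them may be chosen). $SS(L)$ is the total number of bins in the final packing. *)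

(* Defs.v *)
From mathcomp Require Import all_boot all_order all_algebra.

Set Implicit Arguments.
Unset Strict Implicit.
Unset Printing Implicit Defensive.

(* The items of a list are the indices i : 'I_n, in order of arrival, with sizes
   s i.  A bin is the set of its items rather than the multiset of their sizes,
   so a packing is a set of bins even when item sizes repeat. *)

Section Packing.

Variables (B n : nat) (s : 'I_n -> nat).

Implicit Types (b : {set 'I_n}) (P Q : {set {set 'I_n}}) (i : 'I_n).

Definition level b : nat := \sum_(i in b) s i.

(* [partition] excludes empty bins. *)
Definition packing P : bool :=
  partition P [set: 'I_n] && [forall b in P, level b <= B].

Definition singletons : {set {set 'I_n}} := [set [set i] | i : 'I_n].

(* The value is meaningful when every item fits in a bin, since [singletons] is
   then a packing; see [optP]. *)
Definition opt : nat := #|[arg min_(P < singletons | packing P) #|P|]|.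

Definition nbins h P : nat := #|[set b in P | level b == h]|.

Definition ss P : nat := \sum_(1 <= h < B) nbins h P ^ 2.

Definition open_bin P i : {set {set 'I_n}} := [set i] |: P.

Definition add_to P i b : {set {set 'I_n}} := (i |: b) |: (P :\ b).

Definition ss_options P i : {set {set {set 'I_n}}} :=
  open_bin P i |: [set add_to P i b | b in P & level b + s i <= B].

Definition ss_step P i P' : Prop :=
  P' \in ss_options P i /\ forall Q, Q \in ss_options P i -> ss P' <= ss Q.

(* [P t] is the packing of the first t items; only the values P 0, ..., P n are
   constrained.  Ties are broken arbitrarily, so a list may have several runs. *)
Definition ss_run (P : nat -> {set {set 'I_n}}) : Prop :=
  P 0 = set0 /\ forall i, ss_step (P i) i (P i.+1).

Definition ss_packing Q : Prop := exists2 P, ss_run P & P n = Q.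

Lemma packing_singletons : (forall i, s i <= B) -> packing singletons.
Proof.
move=> sB; apply/andP; split; last first.
  by apply/forall_inP=> b /imsetP[i _ ->]; rewrite /level big_set1.
apply/and3P; split.
- rewrite eqEsubset subsetT; apply/subsetP=> i _; apply/bigcupP.
  by exists [set i]; [apply: imset_f | apply: set11].
- apply/trivIsetP=> _ _ /imsetP[i _ ->] /imsetP[j _ ->] ne.
  by rewrite disjoints1 inE; apply: contraNneq ne => ->.
- by apply/imsetP=> -[i _ /setP/(_ i)]; rewrite !inE eqxx.
Qed.

Lemma optP : (forall i, s i <= B) ->
  (exists2 P, packing P & #|P| = opt) /\ (forall P, packing P -> opt <= #|P|).
Proof.
move=> /packing_singletons hS; rewrite /opt.
by case: arg_minnP => // P hP minP; split; [exists P |].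
Qed.

Lemma ss_packing_exists : exists Q, ss_packing Q.
Proof.
pose next P (t : nat) : {set {set 'I_n}} :=
  if insub t is Some i then [arg min_(Q < open_bin P i in ss_options P i) ss Q]
  else P.
pose P := fix F t : {set {set 'I_n}} := if t is u.+1 then next (F u) u else set0.
exists (P n), P => //; split=> // i /=; rewrite /next valK.
by case: arg_minnP => [|Q hQ minQ]; [exact: setU11 | split].
Qed.

End Packing.

(* Main.v *)
Require Import Defs.
From mathcomp Require Import all_boot all_order all_algebra.
From mathcomp Require Import zify ring lra.

Set Implicit Arguments.
Unset Strict Implicit.
Unset Printing Implicit Defensive.

Import Order.TTheory GRing.Theory Num.Theory.

Local Open Scope ring_scope.

(* Let n_h be the number of bins of level h.  If an item of size u opens a new
   bin, comparing with its insertion into a bin of level h shows that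
   n_h <= n_{h+u} whenever h + u < B.  Summation by parts turns this
   monotonicity along the progressions h, h + u, h + 2u, ... into linear
   inequalities on the current packing: it suffices that sums over the final
   segments (up to B) of these progressions be nonnegative.  Call a bin tiny if
   its level is below 2B/25, and let N, C and S be the number of bins, the
   number of tiny bins and the total size.
   - If u < 2B/25 then 6C <= N; only such items create tiny bins, so
     6C <= N + 5 at all times.
   - If u <= 8B/25 then 9BN <= 25S.
   - If 8B/25 < u < 9B/25, the only sparse progressions are the triples
     h, h + u, h + 2u with h tiny, and 10BN <= 25S + 6BC <= 25S + BN + 5B.
   - If u >= 9B/25, the new bin is itself full enough.
   Hence 9BN <= 25S + 9B is preserved by every step. *)

(* F h stands for (a lower bound on) the sum of f over h, h + s, h + 2s, ... *)
Lemma chain_sum_ge0 (B s : nat) (m : nat -> nat) (f F : nat -> int) :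
    (s < B)%N ->
    (forall h, (h + s < B)%N -> (m h <= m (h + s))%N) ->
    (forall h, (h < B)%N -> 0 <= F h) ->
    (forall h, (h + s < B)%N -> F h <= f h + F (h + s)%N) ->
    (forall h, (h < B <= h + s)%N -> F h <= f h) ->
  0 <= \sum_(0 <= h < B) (m h)%:Z * f h.
Proof.
move=> sB mono F0 Fstep Flast.
have shift : \sum_(0 <= h < B - s) (m h)%:Z * F (h + s)%N
    <= \sum_(s <= h < B) (m h)%:Z * F h.
  rewrite -[X in _ <= \sum_(X <= _ < _) _]add0n big_addn !big_nat.
  apply: ler_sum => h /andP[_ hB]; have hsB : (h + s < B)%N by lia.
  by rewrite ler_wpM2r ?F0 // lez_nat mono.
have lowF : \sum_(0 <= h < B - s) (m h)%:Z * F h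
    - \sum_(0 <= h < B - s) (m h)%:Z * F (h + s)%N
    <= \sum_(0 <= h < B - s) (m h)%:Z * f h.
  rewrite -sumrB !big_nat; apply: ler_sum => h /andP[_ hB].
  by rewrite -mulrBr ler_wpM2l // lerBlDr Fstep //; lia.
have highF : \sum_(B - s <= h < B) (m h)%:Z * F h
    <= \sum_(B - s <= h < B) (m h)%:Z * f h.
  rewrite !big_nat; apply: ler_sum => h /andP[hs hB].
  by rewrite ler_wpM2l // Flast //; lia.
have head : 0 <= \sum_(0 <= h < s) (m h)%:Z * F h.
  rewrite big_nat; apply: sumr_ge0 => h /andP[_ hs].
  by rewrite mulr_ge0 // F0 //; lia.
have splitF c : (c <= B)%N -> \sum_(0 <= h < B) (m h)%:Z * F h
    = \sum_(0 <= h < c) (m h)%:Z * F h + \sum_(c <= h < B) (m h)%:Z * F h.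
  by move=> cB; rewrite (@big_cat_nat _ _ _ c).
have := splitF _ (leq_subr s B); rewrite (splitF s) ?(ltnW sB) // => splitF'.
rewrite (@big_cat_nat _ _ _ (B - s)) ?leq_subr //=.
lra.
Qed.

(** * Sums over bins of functions of the level *)

Section Potential.

Variables (B n : nat) (s : 'I_n -> nat).
Implicit Types (b : {set 'I_n}) (P : {set {set 'I_n}}) (i : 'I_n).

Definition pot (phi : nat -> nat) P : nat := \sum_(b in P) phi (level s b).

Local Notation one := (fun=> 1%N).
Local Notation tiny := (fun l => nat_of_bool (25 * l < 2 * B)%N).

Lemma pot_open phi P i :
  [set i] \notin P -> pot phi (open_bin P i) = (phi (s i) + pot phi P)%N.
Proof. by move=> iP; rewrite /pot /open_bin big_setU1 //= /level big_set1. Qed.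

Lemma pot_add phi P i b : b \in P -> i \notin b -> (i |: b) \notin P ->
  (pot phi (add_to P i b) + phi (level s b)
   = phi (level s b + s i) + pot phi P)%N.
Proof.
move=> bP ib ibP; rewrite /pot /add_to big_setU1 /=; last first.
  by rewrite !inE negb_and ibP orbT.
rewrite [in RHS](big_setD1 b) //= [level s (i |: b)]big_setU1 //=.
by rewrite -/(level s b) (addnC (s i)) -addnA; congr (_ + _)%N; rewrite addnC.
Qed.

Lemma card_pot P : #|P| = pot one P.
Proof. by rewrite /pot sum1_card. Qed.

Lemma nbinsE h P : nbins s h P = pot (fun l => l == h) P.
Proof.
rewrite /nbins /pot -sum1_card -big_mkcondr /=.
by apply: eq_bigl => b; rewrite inE.
Qed.

Lemma sum_levels P (f : nat -> int) :
    (forall b, b \in P -> (level s b <= B)%N) ->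
  \sum_(b in P) f (level s b)
  = \sum_(0 <= h < B) (nbins s h P)%:Z * f h + (nbins s B P)%:Z * f B.
Proof.
move=> lev; rewrite -big_nat_recr //= big_mkord.
rewrite (partition_big (fun b => inord (level s b) : 'I_B.+1) xpredT) //=.
apply: eq_bigr => h _; rewrite /nbins -sum1_card -natz natr_sum mulr_suml.
apply: eq_big => [b|b /andP[bP /eqP <-]].
  rewrite inE; case bP: (b \in P) => //=.
  by rewrite -val_eqE /= inordK // ltnS lev.
by rewrite mul1r inordK // ltnS lev.
Qed.

Lemma sum_sqr_incr (m m' : nat -> nat) c : (0 < c < B)%N ->
    (forall k, m' k = m k + (k == c))%N ->
  (\sum_(1 <= k < B) m' k ^ 2 = \sum_(1 <= k < B) m k ^ 2 + (2 * m c).+1)%N.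
Proof.
move=> cB mE; have cin : c \in index_iota 1 B by rewrite mem_index_iota.
rewrite !(bigD1_seq c) ?iota_uniq //= mE eqxx.
rewrite (eq_bigr (fun k => m k ^ 2)%N); last first.
  by move=> k /negPf kc; rewrite mE kc addn0.
rewrite addn1 -addn1 sqrnD; lia.
Qed.

(** With [u = s i], opening adds [2 n_u + 1] to [ss]; filling a bin of level [h] adds
    [2 n_(h+u) + 2 - 2 n_h]. Optimality gives even [n_h + n_u <= n_(h+u)]. *)
Lemma open_mono P i : (s i < B)%N -> (forall j, 0 < s j)%N ->
    (forall b, b \in P -> 0 < level s b)%N ->
    (forall b, b \in P -> i \notin b) ->
    (forall Q, Q \in ss_options B s P i ->
      (ss B s (open_bin P i) <= ss B s Q)%N) ->
  forall h, (h + s i < B)%N -> (nbins s h P <= nbins s (h + s i) P)%N.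
Proof.
move=> siB s0 lev0 iP opt h hB.
have fresh b : (i |: b) \notin P.
  by apply/negP=> /iP; rewrite setU11.
have freshi : [set i] \notin P by apply/negP=> /iP; rewrite set11.
have [->//|] := posnP (nbins s h P).
rewrite /nbins => /card_gt0P[b]; rewrite inE => /andP[bP /eqP lb].
have h0 : (0 < h)%N by rewrite -lb lev0.
have := opt (add_to P i b); have ib := iP b bP.
have -> : add_to P i b \in ss_options B s P i.
  by apply/setU1P; right; apply: imset_f; rewrite inE bP lb ltnW.
move=> /(_ isT); rewrite /ss.
rewrite (@sum_sqr_incr (fun k => nbins s k P) _ (s i)) ?s0 //; last first.
  by move=> k; rewrite !nbinsE pot_open // addnC eq_sym.
(* Subtraction is avoided: raising the new counts at [h] and the old ones at [h + s i] gives the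
   same counts. *)
have potE k : (nbins s k (add_to P i b) + (k == h)
    = nbins s k P + (k == h + s i))%N.
  by rewrite !nbinsE (eq_sym k h) -{1}lb pot_add // lb addnC eq_sym.
have := @sum_sqr_incr (fun k => nbins s k (add_to P i b)) _ h _ (fun k => erefl).
rewrite h0 (leq_ltn_trans (leq_addr _ _) hB) => /(_ isT).
under eq_bigr do rewrite potE.
rewrite (@sum_sqr_incr (fun k => nbins s k P) _ (h + s i)) //; last first.
  by rewrite addn_gt0 h0.
have := potE h; rewrite eqxx -[X in (X == _ + _)%N]addn0 eqn_add2l eq_sym.
rewrite (gtn_eqF (s0 i)) /nbins; lia.
Qed.

(** Full bins lie outside the progressions, so [f B] is checked apart. *)
Lemma sum_levels_ge0 P u (f F : nat -> int) : (u < B)%N ->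
    (forall b, b \in P -> (level s b <= B)%N) ->
    (forall h, (h + u < B)%N -> (nbins s h P <= nbins s (h + u) P)%N) ->
    (forall h, (h < B)%N -> 0 <= F h) ->
    (forall h, (h + u < B)%N -> F h <= f h + F (h + u)%N) ->
    (forall h, (h < B <= h + u)%N -> F h <= f h) ->
    0 <= f B ->
  0 <= \sum_(b in P) f (level s b).
Proof.
move=> uB lev mono F0 Fstep Flast fB.
rewrite sum_levels // addr_ge0 ?mulr_ge0 //.
exact: chain_sum_ge0 Flast.
Qed.

Lemma sum_levels_affine P (a c d : int) :
  \sum_(b in P)
    (a * (level s b)%:Z + c + d * (25 * level s b < 2 * B)%N%:Z)
  = a * (pot id P)%:Z + c * (pot one P)%:Z + d * (pot tiny P)%:Z.
Proof.
have potZ phi : (pot phi P)%:Z = \sum_(b in P) (phi (level s b))%:Z.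
  by rewrite /pot -natz natr_sum; apply: eq_bigr => b _; rewrite natz.
rewrite !potZ !big_split /= -!mulr_sumr; congr (_ + _ + _).
by rewrite mulr_sumr; apply: eq_bigr => b _; rewrite mulr1.
Qed.

(** * Linear inequalities at the opening of a bin *)

Section Opening.

Variables (P : {set {set 'I_n}}) (u : nat).
Hypothesis (u_gt0 : (0 < u)%N) (uB : (u < B)%N).
Hypothesis lev : forall b, b \in P -> (level s b <= B)%N.
Hypothesis mono :
  forall h, (h + u < B)%N -> (nbins s h P <= nbins s (h + u) P)%N.

(** The factor [w] clears the denominator [u] of chain bounds, keeping [F] integral. *)
Lemma affine_ge0 (w : nat) (a c d : int) (F : nat -> int) :
    let f h := a * h%:Z + c + d * (25 * h < 2 * B)%N%:Z in
    (0 < w)%N ->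
    (forall h, (h < B)%N -> 0 <= F h) ->
    (forall h, (h + u < B)%N -> F h <= w%:Z * f h + F (h + u)%N) ->
    (forall h, (h < B <= h + u)%N -> F h <= w%:Z * f h) ->
    0 <= f B ->
  0 <= a * (pot id P)%:Z + c * (pot one P)%:Z + d * (pot tiny P)%:Z.
Proof.
move=> f w0 F0 Fstep Flast fB; rewrite -sum_levels_affine.
rewrite -(pmulr_rge0 _ (_ : 0 < w%:Z)) // mulr_sumr.
exact: (sum_levels_ge0 (f := fun h => w%:Z * f h) uB lev mono F0 Fstep Flast
  (mulr_ge0 _ fB)).
Qed.

(** With so small a step, each chain up to [B] meets at least five larger levels per tiny one. *)
Lemma tiny_bound : (25 * u < 2 * B)%N -> (6 * pot tiny P <= pot one P)%N.
Proof.
move=> u2.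
suff: 0 <= 0 * (pot id P)%:Z + 1 * (pot one P)%:Z + (- 6) * (pot tiny P)%:Z.
  by lia.
(* Slopes -25 and 125 give decrements 25u and -125u per step, as f requires;
   the offset B absorbs the jump at 2B/25, since u is tiny too. *)
pose F h : int := if (25 * h < 2 * B)%N then 125 * h%:Z + B%:Z
                  else 25 * (B%:Z - h%:Z).
apply: (@affine_ge0 (25 * u) _ _ _ F); rewrite /F => *;
  repeat case: ifP => *; lia.
Qed.

(* As 4u >= B in its uses, a chain has at most four terms. *)
Definition chain4 (f : nat -> int) h : int :=
  if (B <= h + u)%N then f h
  else if (B <= h + 2 * u)%N then f h + f (h + u)%N
  else if (B <= h + 3 * u)%N then f h + f (h + u)%N + f (h + 2 * u)%N
  else f h + f (h + u)%N + f (h + 2 * u)%N + f (h + 3 * u)%N.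

Lemma small_bound : (25 * u <= 8 * B)%N ->
  (9 * B * pot one P <= 25 * pot id P)%N.
Proof.
move=> u8; suff: 0 <= 25 * (pot id P)%:Z + (- 9 * B%:Z) * (pot one P)%:Z
  + 0 * (pot tiny P)%:Z by lia.
(* The threshold comes from [G B - G 0 = B * (7 * B - 25 * u)] for the [G] below. *)
have [u7|u7] := leqP (25 * u) (7 * B).
  (* Chains may be long: G(y + u) - G(y) = 2u(25y - 9B), and G(B) bounds from
     below the value of G just beyond the end of the chain. *)
  pose G (y : nat) : int := 25 * y%:Z * (y%:Z - u%:Z) - 18 * B%:Z * y%:Z.
  apply: (@affine_ge0 (2 * u) _ _ _ (fun h => G B - G h)); rewrite ?muln_gt0 //.
  - by move=> h hB; rewrite /G; nia.
  - by move=> h hB; rewrite /G PoszD PoszM; lia.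
  - by move=> h hB; rewrite /G PoszM; nia.
  - lia.
(* A three-term chain starts at [B - 3 * u] or above, so its mean level is at least [B - 2 * u],
   hence at least [9 * B / 25]. *)
pose f (h : nat) : int := 25 * h%:Z - 9 * B%:Z.
apply: (@affine_ge0 1 _ _ _ (chain4 f)); rewrite /chain4 /f => *;
  repeat case: ifP => *; lia.
Qed.

(** A triple starting at a tiny level falls short by at most [30 * B - 75 * u < 6 * B], which the
    weight of its tiny term covers. *)
Lemma medium_bound : (8 * B < 25 * u < 9 * B)%N ->
  (10 * B * pot one P <= 25 * pot id P + 6 * B * pot tiny P)%N.
Proof.
move=> u89; suff: 0 <= 25 * (pot id P)%:Z + (- 10 * B%:Z) * (pot one P)%:Z
  + (6 * B%:Z) * (pot tiny P)%:Z by lia.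
pose f (h : nat) : int :=
  25 * h%:Z - 10 * B%:Z + (if (25 * h < 2 * B)%N then 6 * B%:Z else 0).
apply: (@affine_ge0 1 _ _ _ (chain4 f)); rewrite /chain4 /f => *;
  repeat case: ifP => *; lia.
Qed.

End Opening.

Section Run.

Hypothesis sB : forall i, (1 <= s i <= B)%N.
Variable P : nat -> {set {set 'I_n}}.
Hypothesis run : ss_run B s P.

(** The clause on indices makes the arriving item new to every bin, so the bin formed by a step is
    not already in [P t]. *)
Lemma run_invariant t : (t <= n)%N ->
  [/\ forall b, b \in P t ->
        (0 < level s b <= B)%N /\ {in b, forall j : 'I_n, (j < t)%N},
      pot id (P t) = (\sum_(j < n | j < t) s j)%N,
      (6 * pot tiny (P t) <= pot one (P t) + 5)%N
    & (9 * B * pot one (P t) <= 25 * pot id (P t) + 9 * B)%N].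
Proof.
case: run => P0 step; elim: t => [|t IH] tn.
  rewrite P0 /pot !big_set0 big_pred0 //; split=> // [b|]; last lia.
  by rewrite inE.
have [items sizes few dense] := IH (ltnW tn).
have [i it] : exists i : 'I_n, i = t :> nat by exists (Ordinal tn).
have [] := step i; rewrite it.
have /andP[si0 _] := sB i.
have fresh b : b \in P t -> i \notin b.
  by move=> /items[_ lt_t]; apply/negP => /lt_t; rewrite it ltnn.
have sumS : (\sum_(j < n | j < t.+1) s j = s i + \sum_(j < n | j < t) s j)%N.
  rewrite (bigD1 i) ?it //=; congr (_ + _)%N; apply: eq_bigl => j.
  by rewrite ltnS [(j < t)%N]ltn_neqAle andbC -val_eqE /= it.
(* Filling an existing bin keeps the number of bins, raises the total size and creates no tiny
   bin. *)
case/setU1P => [->|/imsetP[b + ->]] best; last first.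
  rewrite inE => /andP[bP lb].
  have ib := fresh b bP.
  have nP : (i |: b) \notin P t by apply/negP => /fresh; rewrite setU11.
  have potE phi := pot_add phi bP ib nP.
  have := potE one; have := potE id; have := potE tiny.
  rewrite sumS -sizes /= => Ctiny Sid Sone.
  have [/andP[lb0 _] bt] := items b bP.
  split; [|lia..] => b' /setU1P[->|/setD1P[_ /items[-> lt_t]]].
    split; first by rewrite /level big_setU1 //= -/(level s b); lia.
    by move=> j /setU1P[->|/bt/leqW//]; rewrite it.
  by split=> // j /lt_t/leqW.
have nP : [set i] \notin P t by apply/negP => /fresh; rewrite set11.
rewrite !pot_open // sumS -sizes.
have lev b : b \in P t -> (level s b <= B)%N by case/items=> /andP[].
have mono : (s i < B)%N ->
    forall h, (h + s i < B)%N -> (nbins s h (P t) <= nbins s (h + s i) (P t))%N.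
  move=> siB; apply: open_mono best => // [j|b /items[/andP[]]//].
  by have /andP[] := sB j.
split=> //.
- move=> b /setU1P[->|/items[-> lt_t]]; last by split=> // j /lt_t/leqW.
  by rewrite /level big_set1; split=> // j /set1P->; rewrite it.
- case: ltnP => u2 /=; last lia.
  have siB : (s i < B)%N by lia.
  have := tiny_bound si0 siB lev (mono siB) u2; lia.
have [|u9] := leqP (9 * B) (25 * s i); first by rewrite /=; lia.
have siB : (s i < B)%N by lia.
have [u8|u8] := leqP (25 * s i) (8 * B).
  have := small_bound si0 siB lev (mono siB) u8; rewrite /=; lia.
have := medium_bound si0 siB lev (mono siB); rewrite u8 u9 /= => /(_ isT).
(* This leaves an excess of [5 * B] before the step; the new bin adds [9 * B - 25 * s i < B]. *)
have : (B * (6 * pot tiny (P t)) <= B * (pot one (P t) + 5))%N.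
  by rewrite leq_mul2l few orbT.
lia.
Qed.

End Run.

End Potential.

Theorem theorem1 (B n : nat) (s : 'I_n -> nat) (Q : {set {set 'I_n}})
  (hB : (0 < B)%N) (hs : forall i : 'I_n, (1 <= s i <= B)%N)
  (hQ : ss_packing B s Q) :
  #|Q|%:R < 25%:R / 9%:R * ((\sum_(i < n) s i)%N%:R / B%:R) + 2%:R :> rat /\
  25%:R / 9%:R * ((\sum_(i < n) s i)%N%:R / B%:R) + 2%:R
    <= 25%:R / 9%:R * (opt B s)%:R + 2%:R :> rat.
Proof.
have B_gt0 : 0 < B%:R :> rat by rewrite ltr0n.
split.
  case: hQ => P run <-; have [_ sizes _] := run_invariant hs run (leqnn n).
  have -> : pot s id (P n) = (\sum_(i < n) s i)%N.
    by rewrite sizes; apply: eq_bigl => i; rewrite ltn_ord.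
  rewrite (card_pot s).
  set S := (\sum_(i < n) s i)%N => dense.
  have -> : 25%:R / 9%:R * (S%:R / B%:R) + 2%:R
      = (25 * S + 18 * B)%N%:R / (9 * B)%N%:R :> rat.
    by rewrite natrD !natrM; field; rewrite lt0r_neq0.
  (* Strict because the invariant has [9 * B] where [18 * B] is allowed. *)
  by rewrite ltr_pdivlMr ?ltr0n ?muln_gt0 // -natrM ltr_nat; lia.
rewrite lerD2r ler_pM2l ?divr_gt0 ?ltr0n // ler_pdivrMr // -natrM ler_nat.
have [[P /andP[partP /forall_inP levP] <-] _] :
  _ /\ _ := optP (fun i => proj2 (andP (hs i))).
have -> : (\sum_(i < n) s i = \sum_(i in [set: 'I_n]) s i)%N.
  by apply: eq_bigl => i; rewrite inE.
rewrite (set_partition_big _ partP) -sum_nat_const.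
exact: leq_sum.
Qed.
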